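(* Let $y$ be a Vigenère ciphertext over an alphabet $\mathscr{A}$, obtained with a key of length $m$, such that every letter of $\mathscr{A}$ occurs in $y$ with frequency greater than $1$. Let $y_1,\dots,y_m$ be the corresponding $m$ lists and let $\Lambda_{\mathfrak{C}}$ be the Brauer configuration algebra induced by $y$, i.e. the algebra of the Brauer configuration $\mathfrak{C}$ with vertex set $\mathscr{A}$, polygons $y_1,\dots,y_m$, multiplicity function $\mu\equiv 1$, and successor sequences given by $y_1<y_2<\dots<y_m$. Then $$\dim_k\Lambda_{\mathfrak{C}}=2m+|y|(|y|-1)\,\mathscr{I}(y),$$ where $\mathscr{I}(y)$ is the index of coincidence of $y$.
   Context: $k$ is a field and $|y|$ is the length of $y$. Vigenère lists. In the Vigenère cryptosystem with key $K=(k_1,\dots,k_m)$ over an alphabet identified with $\mathbb{Z}_n$, blocks $(p_1,\dots,p_m)$ of plaintext are encrypted as $(p_1+k_1,\dots,p_m+k_m)\bmod n$. For a ciphertext $y$, the list $y_i$ ($1\le i\le m$) consists of the letters of $y$ in positions congruent to $i$ modulo $m$ (the letters encrypted with $k_i$). Each list is regarded as a multiset of letters and, as a polygon, is assumed to have at least two elements counted with multiplicity. Index of coincidence. $\mathscr{I}(y)=\sum_{j\in\mathscr{A}}\frac{f_j(f_j-1)}{|y|(|y|-1)}$, where $f_j$ is the number of occurrences of the letter $j$ in $y$. Brauer configuration. A Brauer configuration consists of a finite set of vertices, a finite (indexed) collection of finite multisets of vertices (polygons), each with at least two elements counted with multiplicity and every vertex lying in some polygon, a multiplicity function $\mu$ from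 vertices to positive integers, and an orientation. The valency $val(v)$ of a vertex $v$ is the sum over all polygons of the number of occurrences of $v$ in the polygon. If the polygons are linearly ordered $U_1<\dots<U_m$, the successor sequence of $v$ is the list of polygons containing $v$ in this order, where $U_i$ is repeated (as consecutive distinct copies) as many times as $v$ occurs in $U_i$; the orientation makes this list into a circular order by declaring the first term to follow the last one. Brauer quiver. The Brauer quiver $Q$ has one vertex for each polygon, and for each vertex $v$ of the configuration and each pair of consecutive terms $U<U'$ in the circular order of $v$ (including the step from the last term to the first) one arrow $U\to U'$; thus $v$ contributes $val(v)$ arrows. For each occurrence of $v$ in a polygon $U$, the special $v$-cycle at $U$ is the cycle of length $val(v)$ that starts at the corresponding copy of $U$ and runs once through the circular order of $v$. Brauer configuration algebra. It is $kQ/I$ where $I$ is generated by: (1) $C^{\mu(v)}-D^{\mu(w)}$ for all special $v$-cycles $C$ and special $w$-cycles $D$ at the same polygon; (2) $C^{\mu(v)}a$, where $C$ is a special $v$-cycle and $a$ is its first arrow; (3) $ab$, for arrows $a,b$ with $ab$ a path in $Q$, unless $a,b$ are consecutive arrows in the circular order of one and the same vertex $v$ (where, if $val(v)=1$, the single loop is regarded as consecutive to itself). *)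

(* Defs.v *)
From HB Require Import structures.
From mathcomp Require Import all_boot all_order all_algebra.
From mathcomp Require Import finmap multiset monalg.
From mathcomp Require Import boolp.

Set Implicit Arguments.
Unset Strict Implicit.
Unset Printing Implicit Defensive.

Import GRing.Theory.

Local Open Scope ring_scope.

(* Finite-dimensionality is part of [lmod_dim]; MathComp's \dim only applies to
   types that already carry a vectType structure. *)
Definition is_basis (k : fieldType) (V : lmodType k) (d : nat) (e : 'I_d -> V) :=
  forall v : V, exists! c : 'rV[k]_d, v = \sum_(i < d) c 0 i *: e i.

Definition lmod_dim (k : fieldType) (V : lmodType k) (d : nat) : Prop :=
  exists e : 'I_d -> V, is_basis e.

Record quiver := Quiver {
  qvertex : finType;
  qarrow : finType;
  qsrc : qarrow -> qvertex;
  qtgt : qarrow -> qvertex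
}.

Section Paths.
Variable Q : quiver.

Fixpoint is_qpath (x : qvertex Q) (s : seq (qarrow Q)) : bool :=
  if s is a :: s' then (qsrc a == x) && is_qpath (qtgt a) s' else true.

(* Paths are read from left to right: in [a :: s] the arrow [a] comes first.
   The starting vertex is recorded so as to have one trivial path per vertex. *)
Record qpath := QPath {
  qpath_val : qvertex Q * seq (qarrow Q);
  _ : is_qpath qpath_val.1 qpath_val.2
}.

HB.instance Definition _ := [isSub for qpath_val].
HB.instance Definition _ := [Choice of qpath by <:].

Definition psource (p : qpath) : qvertex Q := (val p).1.
Definition parrows (p : qpath) : seq (qarrow Q) := (val p).2.
Definition ptarget (p : qpath) : qvertex Q :=
  last (psource p) (map (@qtgt Q) (parrows p)).

Definition ptriv (x : qvertex Q) : qpath := @QPath (x, [::]) isT.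

Fact parrow_subproof (a : qarrow Q) : is_qpath (qsrc a) [:: a].
Proof. by rewrite /= eqxx. Qed.
Definition parrow (a : qarrow Q) : qpath :=
  @QPath (qsrc a, [:: a]) (parrow_subproof a).

Lemma is_qpath_cat x s t :
  is_qpath x (s ++ t) =
  is_qpath x s && is_qpath (last x (map (@qtgt Q) s)) t.
Proof. by elim: s x => //= a s IHs x; rewrite IHs andbA. Qed.

(* [None] stands for the zero product of two paths that do not compose; by
   [path_compE] the [insub] always succeeds when they do. *)
Definition path_comp (p q : qpath) : option qpath :=
  if ptarget p == psource q then insub (psource p, parrows p ++ parrows q)
  else None.

Lemma path_compE p q : ptarget p = psource q ->
  exists2 r, path_comp p q = Some r & val r = (psource p, parrows p ++ parrows q).
Proof.
move=> pq; have rP : is_qpath (psource p) (parrows p ++ parrows q).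
  by rewrite is_qpath_cat [X in X && _](valP p) /= -/(ptarget p) pq (valP q).
by exists (@QPath (_, _) rP) => //; rewrite /path_comp pq eqxx insubT.
Qed.

Lemma path_compN p q : ptarget p != psource q -> path_comp p q = None.
Proof. by rewrite /path_comp => /negPf->. Qed.

Lemma path_compA p q r :
  obind (path_comp p) (path_comp q r) = obind (path_comp^~ r) (path_comp p q).
Proof.
have [pq|npq] := eqVneq (ptarget p) (psource q); last first.
  rewrite (path_compN npq) /=.
  have [qr|nqr] := eqVneq (ptarget q) (psource r); last by rewrite (path_compN nqr).
  by have [t -> tE] := path_compE qr; rewrite /= path_compN // [psource t]/psource tE.
have [s -> sE] := path_compE pq => /=.
have st : ptarget s = ptarget q.
  rewrite /ptarget [psource s]/psource [parrows s]/parrows sE /= map_cat.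
  by rewrite last_cat -/(ptarget p) pq.
have [qr|nqr] := eqVneq (ptarget q) (psource r); last first.
  by rewrite (path_compN nqr) path_compN // st.
have [t -> tE] := path_compE qr => /=.
have pt : ptarget p = psource t by rewrite pq [in RHS]/psource tE.
have sr : ptarget s = psource r by rewrite st.
have [u -> uE] := path_compE pt; have [w -> wE] := path_compE sr.
congr Some; apply: val_inj; rewrite uE wE /psource /parrows sE tE /=.
by rewrite catA.
Qed.

Lemma path_comp1p x p : path_comp (ptriv x) p = if x == psource p then Some p else None.
Proof.
have [->|] := eqVneq x (psource p); last by move=> /(@path_compN (ptriv x)).
have [r -> rE] := @path_compE (ptriv (psource p)) p erefl.
by congr Some; apply: val_inj; rewrite rE [RHS]surjective_pairing.
Qed.

Lemma path_compp1 p x : path_comp p (ptriv x) = if x == ptarget p then Some p else None.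
Proof.
have [->|] := eqVneq x (ptarget p).
  2: by rewrite eq_sym => /(@path_compN p (ptriv x)).
have [r -> rE] := @path_compE p (ptriv (ptarget p)) erefl.
by congr Some; apply: val_inj; rewrite rE cats0 [RHS]surjective_pairing.
Qed.

End Paths.

Definition path_algebra (k : fieldType) (Q : quiver) : Type := {malg k[qpath Q]}.

HB.instance Definition _ (k : fieldType) (Q : quiver) :=
  GRing.Lmodule.copy (path_algebra k Q) {malg k[qpath Q]}.

Lemma malgU_scale (k : fieldType) (K : choiceType) (a c : k) (p : K) :
  << a * c *g p >> = a *: << c *g p >> :> {malg k[K]}.
Proof. by apply/malgP => q; rewrite mcoeffZ !mcoeffU mulrnAr. Qed.

Definition pa_mono (k : fieldType) (Q : quiver) (c : k) (o : option (qpath Q)) :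
    path_algebra k Q :=
  if o is Some r then << c *g r >> else 0.

HB.lock Definition pa_mul (k : fieldType) (Q : quiver) (f g : path_algebra k Q) :
    path_algebra k Q :=
  \sum_(p <- msupp f) \sum_(q <- msupp g) pa_mono (f@_p * g@_q) (path_comp p q).

HB.lock Definition pa_basis (k : fieldType) (Q : quiver) (p : qpath Q) :
    path_algebra k Q := << 1 *g p >>.

Section PathAlgebra.
Variables (k : fieldType) (Q : quiver).

Local Notation kQ := (path_algebra k Q).
Local Notation pa_mul := (@pa_mul k Q).
Local Notation pa_mono := (@pa_mono k Q).

Local Notation pa_basis := (@pa_basis k Q).

Definition pa_arrow (a : qarrow Q) : kQ := pa_basis (parrow a).

Definition pa_one : kQ := \sum_(x : qvertex Q) pa_basis (ptriv x).

Lemma pa_mono0 o : pa_mono 0 o = 0.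
Proof. by case: o => //= r; exact: monalgU0. Qed.

Lemma pa_monoD c d o : pa_mono (c + d) o = pa_mono c o + pa_mono d o.
Proof. by case: o => [r|] /=; [exact: monalgUD | rewrite addr0]. Qed.

Lemma pa_monoZ a c o : pa_mono (a * c) o = a *: pa_mono c o.
Proof.
case: o => [r|] /=; [exact: malgU_scale | by rewrite scaler0].
Qed.

Lemma pa_mulEw (d1 d2 : {fset qpath Q}) (f g : kQ) :
  (msupp f `<=` d1)%fset -> (msupp g `<=` d2)%fset ->
  pa_mul f g = \sum_(p <- d1) \sum_(q <- d2) pa_mono (f@_p * g@_q) (path_comp p q).
Proof.
move=> le1 le2; rewrite pa_mul.unlock (big_fset_incl _ le1) /=.
  apply: eq_bigr => p _; apply: big_fset_incl => // q _ /mcoeff_outdom->.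
  by rewrite mulr0 pa_mono0.
move=> p _ /mcoeff_outdom fp; rewrite big1 // => q _.
by rewrite fp mul0r pa_mono0.
Qed.

Lemma pa_mulDl : left_distributive pa_mul +%R.
Proof.
move=> f g h.
rewrite [in RHS](pa_mulEw (fsubsetUl _ (msupp g)) (fsubset_refl _)).
rewrite [in RHS](pa_mulEw (fsubsetUr (msupp f) _) (fsubset_refl _)).
rewrite (pa_mulEw (msuppD_le _ _) (fsubset_refl _)).
rewrite -big_split /=; apply: eq_bigr => p _.
rewrite -big_split /=; apply: eq_bigr => q _.
by rewrite -pa_monoD -mulrDl -mcoeffD.
Qed.

Lemma pa_mulDr : right_distributive pa_mul +%R.
Proof.
move=> h f g.
rewrite [in RHS](pa_mulEw (fsubset_refl _) (fsubsetUl _ (msupp g))).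
rewrite [in RHS](pa_mulEw (fsubset_refl _) (fsubsetUr (msupp f) _)).
rewrite (pa_mulEw (fsubset_refl _) (msuppD_le _ _)).
rewrite -big_split /=; apply: eq_bigr => p _.
rewrite -big_split /=; apply: eq_bigr => q _.
by rewrite -pa_monoD -mulrDr -mcoeffD.
Qed.

Lemma pa_mul0l : left_zero 0 pa_mul.
Proof. by move=> f; rewrite pa_mul.unlock msupp0 big_seq_fset0. Qed.

Lemma pa_mul0r : right_zero 0 pa_mul.
Proof.
by move=> f; rewrite pa_mul.unlock big1 // => p _; rewrite msupp0 big_seq_fset0.
Qed.

Lemma pa_mulZl a f g : pa_mul (a *: f) g = a *: pa_mul f g.
Proof.
rewrite (pa_mulEw (msuppZ_le _ _) (fsubset_refl _)) [in RHS]pa_mul.unlock scaler_sumr.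
apply: eq_bigr => p _; rewrite scaler_sumr; apply: eq_bigr => q _.
by rewrite mcoeffZ -mulrA -pa_monoZ.
Qed.

Lemma pa_mulZr a f g : pa_mul f (a *: g) = a *: pa_mul f g.
Proof.
rewrite (pa_mulEw (fsubset_refl _) (msuppZ_le _ _)) [in RHS]pa_mul.unlock scaler_sumr.
apply: eq_bigr => p _; rewrite scaler_sumr; apply: eq_bigr => q _.
by rewrite mcoeffZ mulrCA -pa_monoZ.
Qed.

Lemma pa_mulBB p q :
  pa_mul (pa_basis p) (pa_basis q) = oapp pa_basis 0 (path_comp p q).
Proof.
rewrite pa_basis.unlock (pa_mulEw msuppU_le msuppU_le) !big_seq_fset1 !mcoeffUU mulr1.
by case: (path_comp p q).
Qed.

Lemma pa_expand (f : kQ) : f = \sum_(p <- msupp f) f@_p *: pa_basis p.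
Proof.
rewrite [LHS]monalgE; apply: eq_bigr => p _.
by rewrite pa_basis.unlock -[in LHS](mulr1 f@_p); apply: malgU_scale.
Qed.

Lemma pa_mul_suml I (r : seq I) (F : I -> kQ) g :
  pa_mul (\sum_(i <- r) F i) g = \sum_(i <- r) pa_mul (F i) g.
Proof.
exact: (big_morph (pa_mul^~ g) (fun _ _ => pa_mulDl _ _ _) (pa_mul0l _)).
Qed.

Lemma pa_mul_sumr I (r : seq I) (F : I -> kQ) f :
  pa_mul f (\sum_(i <- r) F i) = \sum_(i <- r) pa_mul f (F i).
Proof.
exact: (big_morph (pa_mul f) (fun _ _ => pa_mulDr _ _ _) (pa_mul0r _)).
Qed.

Lemma pa_mulA : associative pa_mul.
Proof.
have mulBBB p q r : pa_mul (pa_basis p) (pa_mul (pa_basis q) (pa_basis r)) =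
                    pa_mul (pa_mul (pa_basis p) (pa_basis q)) (pa_basis r).
  rewrite !pa_mulBB; have := path_compA p q r.
  case: (path_comp q r) => [t|]; case: (path_comp p q) => [s|] /= e.
  - by rewrite !pa_mulBB e.
  - by rewrite pa_mulBB e pa_mul0l.
  - by rewrite pa_mulBB -e pa_mul0r.
  - by rewrite pa_mul0l pa_mul0r.
have mulfBB f q r : pa_mul f (pa_mul (pa_basis q) (pa_basis r)) =
                    pa_mul (pa_mul f (pa_basis q)) (pa_basis r).
  rewrite (pa_expand f) pa_mul_suml.
  rewrite [X in _ = pa_mul X _]pa_mul_suml [RHS]pa_mul_suml.
  by apply: eq_bigr => p _; rewrite !pa_mulZl mulBBB.
have mulfgB f g r : pa_mul f (pa_mul g (pa_basis r)) =
                    pa_mul (pa_mul f g) (pa_basis r).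
  rewrite (pa_expand g) pa_mul_suml pa_mul_sumr.
  rewrite [X in _ = pa_mul X _]pa_mul_sumr [RHS]pa_mul_suml.
  apply: eq_bigr => q _.
  apply: etrans (congr1 (pa_mul f) (pa_mulZl _ _ _)) _.
  apply: etrans _ (esym (congr1 (pa_mul^~ _) (pa_mulZr _ _ _))).
  apply: etrans (pa_mulZr _ _ _) (etrans _ (esym (pa_mulZl _ _ _))).
  exact: congr1 (mulfBB f q r).
move=> f g h; rewrite (pa_expand h) [pa_mul g _]pa_mul_sumr [LHS]pa_mul_sumr.
rewrite [RHS]pa_mul_sumr; apply: eq_bigr => r _.
by rewrite [pa_mul g _]pa_mulZr [LHS]pa_mulZr [RHS]pa_mulZr mulfgB.
Qed.

Lemma pa_mul1l : left_id pa_one pa_mul.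
Proof.
move=> f; rewrite [in RHS](pa_expand f) {1}(pa_expand f) pa_mul_sumr.
apply: eq_bigr => p _; rewrite pa_mulZr pa_mul_suml; congr (_ *: _).
under eq_bigr do rewrite pa_mulBB path_comp1p.
rewrite (bigD1 (psource p)) //= eqxx big1 ?addr0 // => x.
by move=> /negPf->.
Qed.

Lemma pa_mul1r : right_id pa_one pa_mul.
Proof.
move=> f; rewrite [in RHS](pa_expand f) {1}(pa_expand f) pa_mul_suml.
apply: eq_bigr => p _; rewrite pa_mulZl pa_mul_sumr; congr (_ *: _).
under eq_bigr do rewrite pa_mulBB path_compp1.
rewrite (bigD1 (ptarget p)) //= eqxx big1 ?addr0 // => x.
by move=> /negPf->.
Qed.

(* Only a pzRingType (possibly zero ring): the quiver may have no vertex. *)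
HB.instance Definition _ := GRing.Zmodule_isPzRing.Build (path_algebra k Q)
  pa_mulA pa_mul1l pa_mul1r pa_mulDl pa_mulDr.

Lemma pa_scalerAl (c : k) (f g : kQ) : c *: (f * g) = (c *: f) * g.
Proof. by rewrite [RHS]pa_mulZl. Qed.

Lemma pa_scalerAr (c : k) (f g : kQ) : c *: (f * g) = f * (c *: g).
Proof. by rewrite [RHS]pa_mulZr. Qed.

End PathAlgebra.

Definition gen_ideal (R : pzRingType) (S : R -> Prop) (x : R) : Prop :=
  exists (n : nat) (a s b : 'I_n -> R),
    (forall i, S (s i)) /\ x = \sum_(i < n) a i * s i * b i.

Section GenIdeal.
Variables (R : pzRingType) (S : R -> Prop).

Lemma gen_ideal0 : gen_ideal S 0.
Proof.
by exists 0, (fun=> 0), (fun=> 0), (fun=> 0); split=> [[]|] //; rewrite big_ord0.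
Qed.

Lemma gen_idealD x y : gen_ideal S x -> gen_ideal S y -> gen_ideal S (x + y).
Proof.
move=> [n [a [s [b [sS ->]]]]] [m [a' [s' [b' [sS' ->]]]]].
pose c (f : 'I_n -> R) (f' : 'I_m -> R) (i : 'I_(n + m)) :=
  match split i with inl j => f j | inr j => f' j end.
exists (n + m)%N, (c a a'), (c s s'), (c b b'); split.
  by move=> i; rewrite /c; case: (split i).
rewrite big_split_ord /=; congr (_ + _); apply: eq_bigr => i _; rewrite /c.
  by rewrite (unsplitK (inl i)).
by rewrite (unsplitK (inr i)).
Qed.

Lemma gen_idealMl a x : gen_ideal S x -> gen_ideal S (a * x).
Proof.
move=> [n [a' [s [b [sS ->]]]]]; exists n, (fun i => a * a' i), s, b; split=> //.
by rewrite mulr_sumr; apply: eq_bigr => i _; rewrite !mulrA.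
Qed.

Lemma gen_idealMr a x : gen_ideal S x -> gen_ideal S (x * a).
Proof.
move=> [n [a' [s [b [sS ->]]]]]; exists n, a', s, (fun i => b i * a); split=> //.
by rewrite mulr_suml; apply: eq_bigr => i _; rewrite !mulrA.
Qed.

Lemma gen_idealN x : gen_ideal S x -> gen_ideal S (- x).
Proof. by rewrite -mulN1r; apply: gen_idealMl. Qed.

Lemma gen_ideal_sub x : S x -> gen_ideal S x.
Proof.
move=> Sx; exists 1%N, (fun=> 1), (fun=> x), (fun=> 1); split=> //.
by rewrite big_ord1 mul1r mulr1.
Qed.

Definition ideal_pred : pred R := fun x => `[< gen_ideal S x >].

Lemma ideal_predP x : reflect (gen_ideal S x) (x \in ideal_pred).
Proof. exact: asboolP. Qed.

Fact ideal_pred_zmod : zmod_closed ideal_pred.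
Proof.
split=> [|x y /ideal_predP xI /ideal_predP yI]; apply/ideal_predP.
  exact: gen_ideal0.
by apply: gen_idealD => //; apply: gen_idealN.
Qed.

HB.instance Definition _ := GRing.isZmodClosed.Build R ideal_pred ideal_pred_zmod.

Definition gen_ideal_zmod : zmodClosed R := GRing.ZmodClosed.clone R ideal_pred _.

End GenIdeal.

Section QuotientAlgebra.
Variables (k : fieldType) (Q : quiver) (S : path_algebra k Q -> Prop).
Local Notation kQ := (path_algebra k Q).
Local Open Scope quotient_scope.

Definition quotient_algebra : Type := Quotient.quot (gen_ideal_zmod S).

HB.instance Definition _ := GRing.Zmodule.copy quotient_algebra
  (Quotient.quot (gen_ideal_zmod S)).

Local Notation L := quotient_algebra.

Definition qproj (f : kQ) : L := \pi_(Quotient.quot (gen_ideal_zmod S)) f.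
Definition qrepr (x : L) : kQ := repr (x : Quotient.quot (gen_ideal_zmod S)).

Lemma qreprK x : qproj (qrepr x) = x.
Proof. exact: reprK. Qed.

Lemma qprojP f g : qproj f = qproj g <-> gen_ideal S (f - g).
Proof.
split=> [e|fgI].
  by apply/ideal_predP; rewrite Quotient.idealrBE; apply/eqP.
by apply/eqP; rewrite -Quotient.idealrBE; apply/ideal_predP.
Qed.

Lemma qprojD f g : qproj (f + g) = qproj f + qproj g.
Proof. exact: pi_addr. Qed.

Lemma qrepr_qproj f : gen_ideal S (qrepr (qproj f) - f).
Proof. by apply/qprojP; rewrite qreprK. Qed.

Definition qscale (c : k) (x : L) : L := qproj (c *: qrepr x).
Definition qmul (x y : L) : L := qproj (qrepr x * qrepr y).

Lemma gen_idealZ c (f : kQ) : gen_ideal S f -> gen_ideal S (c *: f).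
Proof. by move=> fI; rewrite -[f]mul1r pa_scalerAl; apply: gen_idealMl. Qed.

Lemma qprojZ c f : qproj (c *: f) = qscale c (qproj f).
Proof.
apply/esym/qprojP; rewrite -scalerBr; apply: gen_idealZ; exact: qrepr_qproj.
Qed.

Lemma qprojM f g : qproj (f * g) = qmul (qproj f) (qproj g).
Proof.
apply/esym/qprojP; set f' := qrepr _; set g' := qrepr _.
have -> : f' * g' - f * g = (f' - f) * g' + f * (g' - g).
  by rewrite mulrBl mulrBr addrA addrNK.
by apply: gen_idealD; [apply: gen_idealMr | apply: gen_idealMl];
   apply: qrepr_qproj.
Qed.

Fact qscaleA a b x : qscale a (qscale b x) = qscale (a * b) x.
Proof. by rewrite -[x]qreprK -!qprojZ scalerA. Qed.
Fact qscale1 : left_id 1 qscale.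
Proof. by move=> x; rewrite -[x]qreprK -qprojZ scale1r. Qed.
Fact qscaleDr : right_distributive qscale +%R.
Proof.
by move=> a x y; rewrite -[x]qreprK -[y]qreprK -qprojD -!qprojZ scalerDr qprojD.
Qed.
Fact qscaleDl x : {morph qscale^~ x : a b / a + b}.
Proof. by move=> a b; rewrite -[x]qreprK -!qprojZ scalerDl qprojD. Qed.

HB.instance Definition _ := GRing.Zmodule_isLmodule.Build k quotient_algebra
  qscaleA qscale1 qscaleDr qscaleDl.

Fact qmulA : associative qmul.
Proof.
by move=> x y z; rewrite -[x]qreprK -[y]qreprK -[z]qreprK -!qprojM mulrA.
Qed.
Fact qmul1l : left_id (qproj 1) qmul.
Proof. by move=> x; rewrite -[x]qreprK -qprojM mul1r. Qed.
Fact qmul1r : right_id (qproj 1) qmul.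
Proof. by move=> x; rewrite -[x]qreprK -qprojM mulr1. Qed.
Fact qmulDl : left_distributive qmul +%R.
Proof.
move=> x y z; rewrite -[x]qreprK -[y]qreprK -[z]qreprK.
by rewrite -qprojD -!qprojM mulrDl qprojD.
Qed.
Fact qmulDr : right_distributive qmul +%R.
Proof.
move=> x y z; rewrite -[x]qreprK -[y]qreprK -[z]qreprK.
by rewrite -qprojD -!qprojM mulrDr qprojD.
Qed.

HB.instance Definition _ := GRing.Zmodule_isPzRing.Build quotient_algebra
  qmulA qmul1l qmul1r qmulDl qmulDr.

Lemma quotient_scalerAl (c : k) (x y : L) : c *: (x * y) = (c *: x) * y.
Proof.
rewrite -[x]qreprK -[y]qreprK -[_ * _]qprojM -[LHS]qprojZ pa_scalerAl qprojM.
by rewrite qprojZ.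
Qed.

Lemma quotient_scalerAr (c : k) (x y : L) : c *: (x * y) = x * (c *: y).
Proof.
rewrite -[x]qreprK -[y]qreprK -[_ * _]qprojM -[LHS]qprojZ pa_scalerAr qprojM.
by rewrite qprojZ.
Qed.

End QuotientAlgebra.

(* The orientation is given, for each vertex [v], by a list of polygons taken
   up to rotation.  The distinct copies of a polygon [U] in the circular order
   of [v] are the positions of [bc_order v] that hold [U]; by [bc_orderP] there
   are as many of them as occurrences of [v] in [U]. *)
Record brauer_configuration := BrauerConfiguration {
  bc_vertex : finType;
  bc_index : finType;
  bc_polygon : bc_index -> multiset bc_vertex;
  bc_polygon_size : forall U, (1 < size (bc_polygon U))%N;
  bc_cover : forall v, exists U, v \in bc_polygon U;
  bc_mu : bc_vertex -> nat;
  bc_mu_gt0 : forall v, (0 < bc_mu v)%N;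
  bc_order : bc_vertex -> seq bc_index;
  bc_orderP : forall v U, count_mem U (bc_order v) = bc_polygon U v
}.

Section BrauerQuiver.
Variable C : brauer_configuration.

Definition valency (v : bc_vertex C) : nat :=
  \sum_(U : bc_index C) bc_polygon U v.

Fact size_bc_order v : size (bc_order v) == valency v.
Proof.
rewrite -(sum1_size (bc_order v)) /valency; apply/eqP.
under [RHS]eq_bigr do rewrite -bc_orderP -sum1_count.
rewrite (exchange_big_dep xpredT) //=; apply: eq_bigr => U _.
by rewrite (big_pred1 U) // => W; rewrite /= eq_sym.
Qed.

Definition circ_order (v : bc_vertex C) : (valency v).-tuple (bc_index C) :=
  Tuple (size_bc_order v).

(* The arrow [Tagged _ i] with tag [v] is the step of the circular order of [v]
   from its i-th term to the next one; [ordS] wraps around. *)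
Definition barrow : finType := {v : bc_vertex C & 'I_(valency v)}.

Definition mk_barrow v (i : 'I_(valency v)) : barrow :=
  Tagged (fun w => 'I_(valency w)) i.

Definition barrow_next (a : barrow) : barrow := mk_barrow (ordS (tagged a)).

Definition barrow_src (a : barrow) : bc_index C :=
  tnth (circ_order (tag a)) (tagged a).
Definition barrow_tgt (a : barrow) : bc_index C :=
  tnth (circ_order (tag a)) (ordS (tagged a)).

Definition brauer_quiver : quiver :=
  @Quiver (bc_index C) barrow barrow_src barrow_tgt.

Fact special_cycle_subproof v (i : 'I_(valency v)) :
  @is_qpath brauer_quiver (tnth (circ_order v) i)
    (traject barrow_next (mk_barrow i) (valency v)).
Proof.
have gen n (a : barrow) :
    @is_qpath brauer_quiver (barrow_src a) (traject barrow_next a n).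
  by elim: n a => //= n IHn a; rewrite eqxx /=; apply: (IHn (barrow_next a)).
exact: (gen _ (mk_barrow i)).
Qed.

(* The position i plays the role of the occurrence of v: the cycle is based at
   the polygon that is the i-th term of the circular order of v. *)
Definition special_cycle v (i : 'I_(valency v)) : qpath brauer_quiver :=
  @QPath brauer_quiver (_, _) (special_cycle_subproof i).

Lemma ptarget_special_cycle v (i : 'I_(valency v)) :
  ptarget (special_cycle i) = psource (special_cycle i).
Proof.
have itS n (j : 'I_(valency v)) : (iter n (@ordS _) j = (j + n) %% valency v :> nat)%N.
  elim: n => [|n IHn] /=; first by rewrite addn0 modn_small.
  by rewrite IHn -[(_ %% _).+1]addn1 modnDml addn1 addnS.
have itA n (j : 'I_(valency v)) :
    iter n barrow_next (mk_barrow j) = mk_barrow (iter n (@ordS _) j).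
  by elim: n => //= n ->.
rewrite /ptarget /psource /parrows /=.
have v_gt0 : (0 < valency v)%N by apply: leq_ltn_trans (ltn_ord i).
rewrite -[X in traject _ _ X](prednK v_gt0) trajectS /= last_map last_traject.
rewrite itA /barrow_tgt /=; congr tnth; apply: val_inj.
apply: etrans (itS (valency v).-1.+1 i) _.
by rewrite prednK // modnDr modn_small.
Qed.

Variable k : fieldType.
Local Notation kQ := (path_algebra k brauer_quiver).

Definition cycle_elt v (i : 'I_(valency v)) : kQ := pa_basis k (special_cycle i).
Definition arrow_elt (a : barrow) : kQ := @pa_arrow k brauer_quiver a.

(* In the second family the first arrow of [special_cycle i] is [mk_barrow i].
   In the third one, [b = barrow_next a] means that a and b are consecutive in
   the circular order of one vertex; for valency 1 it reads [b = a]. *)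
Inductive brauer_relation : kQ -> Prop :=
| BrauerRel1 v w (i : 'I_(valency v)) (j : 'I_(valency w)) of
    tnth (circ_order v) i = tnth (circ_order w) j :
    brauer_relation (cycle_elt i ^+ bc_mu v - cycle_elt j ^+ bc_mu w)
| BrauerRel2 v (i : 'I_(valency v)) :
    brauer_relation (cycle_elt i ^+ bc_mu v * arrow_elt (mk_barrow i))
| BrauerRel3 (a b : barrow) of
    barrow_tgt a = barrow_src b & b <> barrow_next a :
    brauer_relation (arrow_elt a * arrow_elt b).

Definition brauer_algebra : Type := quotient_algebra brauer_relation.

HB.instance Definition _ := GRing.Lmodule.on brauer_algebra.
HB.instance Definition _ := GRing.PzRing.on brauer_algebra.

End BrauerQuiver.

(* The polygons are ordered by their index: U 0 < ... < U (m-1). *)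
Definition successor_sequence (V : finType) (m : nat) (U : 'I_m -> multiset V)
    (v : V) : seq 'I_m :=
  flatten [seq nseq (U i v) i | i <- enum 'I_m].

Lemma count_successor_sequence (V : finType) (m : nat) (U : 'I_m -> multiset V) v i :
  count_mem i (successor_sequence U v) = U i v.
Proof.
rewrite count_flatten -map_comp sumnE big_map big_enum /= (bigD1 i) //=.
rewrite count_nseq /= eqxx mul1n big1 ?addn0 // => j /negPf ji.
by rewrite count_nseq /= ji.
Qed.

(* [code] and [decode] identify the alphabet with the integers modulo n.+1, and
   the sum is the addition modulo n.+1 of 'I_n.+1.  Positions are 0-based: the
   letter in position j is encrypted with the key letter of index j %% m, so
   that the last block may be incomplete. *)
Definition vigenere_encrypt (A : finType) (n : nat) (code : A -> 'I_n.+1)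
    (decode : 'I_n.+1 -> A) (m : nat) (K : m.-tuple 'I_n.+1) (x : seq A) : seq A :=
  [seq decode (code c.1 + c.2)
     | c <- zip x [seq nth 0 K (j %% m) | j <- iota 0 (size x)]].

(* The list y_(i+1): 1-based positions congruent to i+1 modulo m are 0-based
   positions congruent to i. *)
Definition vigenere_list (A : finType) (m : nat) (y : seq A) (i : 'I_m) : seq A :=
  mask [seq (j == i %[mod m])%N | j <- iota 0 (size y)] y.

Lemma vigenere_listE (A : finType) (a0 : A) m (y : seq A) (i : 'I_m) :
  vigenere_list y i =
  [seq nth a0 y j | j <- iota 0 (size y) & (j == i %[mod m])%N].
Proof. by rewrite filter_mask map_mask map_nth_iota0 // take_size. Qed.

Definition index_of_coincidence (A : finType) (y : seq A) : rat :=
  \sum_(j : A) ((count_mem j y)%:R * ((count_mem j y)%:R - 1))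
               / ((size y)%:R * ((size y)%:R - 1)).

Section VigenereConfiguration.
Variables (A : finType) (m : nat) (y : seq A).
Hypothesis m_gt0 : (0 < m)%N.
Hypothesis y_freq : forall a : A, (1 < count_mem a y)%N.
Hypothesis y_lists : forall i : 'I_m, (1 < size (vigenere_list y i))%N.

Definition vigenere_polygon (i : 'I_m) : multiset A := seq_mset (vigenere_list y i).

Fact vigenere_polygon_size i : (1 < size (vigenere_polygon i))%N.
Proof. by rewrite (perm_size (perm_eq_seq_mset _)). Qed.

Fact vigenere_cover a : exists i, a \in vigenere_polygon i.
Proof.
have ay : a \in y by rewrite -has_pred1 has_count (ltn_trans _ (y_freq a)).
have lt_im : (index a y %% m < m)%N by rewrite ltn_pmod.
exists (Ordinal lt_im); rewrite (perm_mem (perm_eq_seq_mset _)).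
have iy : (index a y < size y)%N by rewrite index_mem.
rewrite (vigenere_listE a); apply/mapP; exists (index a y).
  by rewrite mem_filter mem_iota /= modn_mod eqxx iy.
by rewrite nth_index.
Qed.

Definition vigenere_configuration : brauer_configuration :=
  @BrauerConfiguration A 'I_m vigenere_polygon vigenere_polygon_size
    vigenere_cover (fun=> 1%N) (fun=> isT)
    (successor_sequence vigenere_polygon)
    (count_successor_sequence vigenere_polygon).

End VigenereConfiguration.

(* Main.v *)
(* Call a path a chain if each of its arrows is followed by the next one in the
   circular order of a vertex v.  By (3), every path that is not a chain is zero
   in the quotient; by (2), so is every chain longer than L(v) = mu(v) val(v).
   Chains of length exactly L(v) are the powers C^mu(v), identified by (1) when
   they start at the same polygon.  Hence the trivial paths, one chain of full
   length per polygon, and the chains of length 1, ..., L(v) - 1 span, giving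
   2 |polygons| + sum_v val(v) (L(v) - 1).  They are independent because the map
   sending each path to its normal form kills p r q for every relation r and all
   paths p, q: if p or q is nontrivial, the two terms of p (C^mu - D^mu) q are
   both zero in normal form.  For a Vigenere ciphertext mu = 1 and val(a) is the
   frequency of a, so the sum is the numerator of the index of coincidence. *)

Require Import Defs.
From mathcomp Require Import all_boot all_order all_algebra.
From mathcomp Require Import finmap multiset monalg.

Set Implicit Arguments.
Unset Strict Implicit.
Unset Printing Implicit Defensive.

Import GRing.Theory Num.Theory.

Local Open Scope ring_scope.

(** * Dimension of a quotient of a path algebra from normal forms of paths *)

Section NormalForms.
Variables (k : fieldType) (Q : quiver).
Local Notation kQ := (path_algebra k Q).

(** Linear extension of the indicator of the paths with normal form [b]; [None] marks the paths that
    are to vanish in the quotient. *)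
Definition nf_coord (B : eqType) (nf : qpath Q -> option B) (b : B) (f : kQ) : k :=
  mmap idfun (fun p => (nf p == Some b)%:R) f.

Section NormalFormCoordinate.
Variables (B : eqType) (nf : qpath Q -> option B) (b : B).
Local Notation phi := (nf_coord nf b).

Lemma nf_coordD : {morph phi : f g / f + g}.
Proof. exact: mmapD. Qed.

Lemma nf_coord0 : phi 0 = 0.
Proof. exact: mmap0. Qed.

Lemma nf_coordB : {morph phi : f g / f - g}.
Proof. exact: mmapB. Qed.

Lemma nf_coordZ c f : phi (c *: f) = c * phi f.
Proof.
rewrite /nf_coord [LHS](mmapEw (msuppZ_le _ _)) mmapE mulr_sumr.
by apply: eq_bigr => p _; rewrite mcoeffZ mulrA.
Qed.

Lemma nf_coord_basis p : phi (pa_basis k p) = (nf p == Some b)%:R.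
Proof. by rewrite pa_basis.unlock /nf_coord [LHS]mmapU mul1r. Qed.

Lemma nf_coord_sum I r (P : pred I) (F : I -> kQ) :
  phi (\sum_(i <- r | P i) F i) = \sum_(i <- r | P i) phi (F i).
Proof. exact: (big_morph _ nf_coordD nf_coord0). Qed.

(** Expanding the outer factors of each summand in the path basis leaves only products [p * s * q]
    with [p] and [q] paths. *)
Lemma nf_coord_ideal (S : kQ -> Prop) :
  (forall s p q, S s -> phi (pa_basis k p * s * pa_basis k q) = 0) ->
  forall f, gen_ideal S f -> phi f = 0.
Proof.
move=> S0 _ [n [u [s [w [sS ->]]]]]; rewrite nf_coord_sum big1 // => i _.
rewrite (pa_expand (u i)) (pa_expand (w i)) mulr_sumr nf_coord_sum big1 // => q _.
rewrite !mulr_suml nf_coord_sum big1 // => p _.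
by rewrite -pa_scalerAr nf_coordZ -!pa_scalerAl nf_coordZ S0 ?mulr0.
Qed.

End NormalFormCoordinate.

Variable S : kQ -> Prop.

Lemma qproj_sum I r (P : pred I) (F : I -> kQ) :
  qproj S (\sum_(i <- r | P i) F i) = \sum_(i <- r | P i) qproj S (F i).
Proof.
apply: (big_morph _ (@qprojD k Q S)).
by apply: (addrI (qproj S 0)); rewrite -qprojD !addr0.
Qed.

Lemma qproj_eq0 f : gen_ideal S f -> qproj S f = 0.
Proof.
move=> If; have -> : 0 = qproj S 0 by have := qproj_sum [::] xpredT id; rewrite !big_nil.
by apply/qprojP; rewrite subr0.
Qed.

(** The [rep b] span, since every path is congruent to one of them or to zero. The functionals
    [nf_coord nf b] vanish on the ideal, so they descend to the quotient, where they are dual to the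
    [rep b]; this makes the coefficients unique. *)
Theorem quotient_dim_nf (B : finType) (rep : B -> qpath Q) (nf : qpath Q -> option B) :
    (forall b, nf (rep b) = Some b) ->
    (forall p, qproj S (pa_basis k p) =
               oapp (fun b => qproj S (pa_basis k (rep b))) 0 (nf p)) ->
    (forall b s p q, S s -> nf_coord nf b (pa_basis k p * s * pa_basis k q) = 0) ->
  lmod_dim (quotient_algebra S) #|B|.
Proof.
move=> repK nfE S0.
have phiP b f g : qproj S f = qproj S g -> nf_coord nf b f = nf_coord nf b g.
  move/qprojP => I; apply/eqP; rewrite -subr_eq0 -nf_coordB; apply/eqP.
  exact: nf_coord_ideal (S0 b) _ I.
exists (fun i => qproj S (pa_basis k (rep (enum_val i)))) => v.
have eE (c : 'rV[k]_#|B|) :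
    \sum_i c 0 i *: qproj S (pa_basis k (rep (enum_val i)))
    = qproj S (\sum_i c 0 i *: pa_basis k (rep (enum_val i))).
  by rewrite qproj_sum; apply: eq_bigr => i _; rewrite qprojZ.
exists (\row_i nf_coord nf (enum_val i) (qrepr v)); split=> [|c vE].
  rewrite -{1}[v]qreprK; move: (qrepr v) => f.
  rewrite {1}(pa_expand f) qproj_sum.
  (* Each term is spread over all of [B], with at most one non-zero summand, so that the two sums
     can be exchanged. *)
  transitivity (\sum_(p <- msupp f) \sum_(b : B)
      (f@_p * (nf p == Some b)%:R) *: qproj S (pa_basis k (rep b))).
    apply: eq_bigr => p _; rewrite qprojZ nfE; case: (nf p) => [b|] /=.
      rewrite (bigD1 b) //= eqxx mulr1 big1 ?addr0 // => b' b'b.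
      by rewrite (inj_eq Some_inj) eq_sym (negPf b'b) mulr0 scale0r.
    by rewrite big1 => [|b _]; [exact: scaler0 | rewrite mulr0 scale0r].
  rewrite exchange_big /= (reindex _ (onW_bij _ (@enum_val_bij B))) /=.
  by apply: eq_bigr => i _; rewrite mxE -scaler_suml.
apply/rowP => i; rewrite mxE.
have {}vE : qproj S (qrepr v)
            = qproj S (\sum_i c 0 i *: pa_basis k (rep (enum_val i))).
  by rewrite qreprK vE eE.
have coordE j : nf_coord nf (enum_val i) (c 0 j *: pa_basis k (rep (enum_val j)))
                = c 0 j * (j == i)%:R.
  rewrite nf_coordZ nf_coord_basis repK.
  by rewrite (inj_eq Some_inj) (inj_eq enum_val_inj).
rewrite (phiP (enum_val i) _ _ vE) nf_coord_sum (eq_bigr _ (fun j _ => coordE j)).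
by rewrite (bigD1 i) //= eqxx mulr1 big1 ?addr0 // => j /negPf->; rewrite mulr0.
Qed.

End NormalForms.

(** * Products of paths *)

Section PathProducts.
Variables (k : fieldType) (Q : quiver).
Local Notation pa_basis := (@pa_basis k Q).

Lemma pa_basis_cat (p q r : qpath Q) :
    ptarget p = psource q -> psource r = psource p ->
    parrows r = parrows p ++ parrows q ->
  pa_basis r = pa_basis p * pa_basis q.
Proof.
move=> pq rp rpq; have [t tE tv] := path_compE pq.
rewrite [RHS]pa_mulBB tE /=; congr (pa_basis _); apply: val_inj.
by rewrite tv -rp -rpq [LHS]surjective_pairing.
Qed.

(* [r] and [r'] are parallel, so both products vanish or neither does. *)
Lemma pa_basis_mul3 (p q r : qpath Q) :
  (forall r', psource r' = psource r -> ptarget r' = ptarget r ->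
     pa_basis p * pa_basis r' * pa_basis q = 0) \/
  (forall r', psource r' = psource r -> ptarget r' = ptarget r ->
     exists2 t, pa_basis p * pa_basis r' * pa_basis q = pa_basis t
              & val t = (psource p, parrows p ++ parrows r' ++ parrows q)).
Proof.
have [pr|npr] := eqVneq (ptarget p) (psource r); last first.
  left=> r' rs _; rewrite [pa_basis p * _]pa_mulBB path_compN ?rs //=.
  by rewrite mul0r.
have [rq|nrq] := eqVneq (ptarget r) (psource q); last first.
  left=> r' _ rt; rewrite -mulrA [pa_basis r' * _]pa_mulBB path_compN ?rt //=.
  by rewrite mulr0.
right=> r' rs rt; rewrite -rt in rq; rewrite -rs in pr.
have [u uE uv] := path_compE rq.
have pu : ptarget p = psource u by rewrite pr [RHS]/psource uv.
have [t tE tv] := path_compE pu.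
exists t; last by rewrite tv [parrows u]/parrows uv.
by rewrite -mulrA [pa_basis r' * _]pa_mulBB uE /= [LHS]pa_mulBB tE.
Qed.

End PathProducts.

(** The first place where the sequence ceases to follow [f]; for the circular order this exhibits a
    factor killed by relation (3). *)
Lemma not_fpath_split (T : eqType) (f : T -> T) x s :
  ~~ fpath f x s -> exists s1 a b s2, x :: s = s1 ++ [:: a, b & s2] /\ b <> f a.
Proof.
elim: s x => //= y s IHs x; have [<-|/eqP fxy] := eqVneq (f x) y.
  by move=> /= /IHs[s1 [a [b [s2 [-> ab]]]]]; exists (x :: s1), a, b, s2.
by move=> _; exists [::], x, y, s; split=> // yfx; apply: fxy.
Qed.

(** * Chains in the Brauer quiver *)

Section BrauerDimension.
Variable C : brauer_configuration.
Local Notation Q := (brauer_quiver C).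
Local Notation next := (@barrow_next C).

Definition cyc_len (v : bc_vertex C) : nat := (bc_mu v * valency v)%N.

Lemma cyc_len_gt0 v (i : 'I_(valency v)) : (0 < cyc_len v)%N.
Proof. by rewrite muln_gt0 bc_mu_gt0 (leq_ltn_trans _ (ltn_ord i)). Qed.

Lemma tag_iter_next n (a : barrow C) : tag (iter n next a) = tag a.
Proof. by elim: n. Qed.

Lemma iter_next_valency (a : barrow C) : iter (valency (tag a)) next a = a.
Proof.
case: a => v i; rewrite -[existT _ v i]/(mk_barrow i) [tag _]/=.
have itS n : (iter n (@ordS _) i = (i + n) %% valency v :> nat)%N.
  elim: n => [|n IHn] /=; first by rewrite addn0 modn_small.
  by rewrite IHn -[(_ %% _).+1]addn1 modnDml addn1 addnS.
have itA n : iter n next (mk_barrow i) = mk_barrow (iter n (@ordS _) i).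
  by elim: n => //= n ->.
rewrite itA; congr mk_barrow; apply: val_inj.
by rewrite /= itS modnDr modn_small.
Qed.

Lemma iter_next_cyc_len (a : barrow C) : iter (cyc_len (tag a)) next a = a.
Proof. by rewrite iterM; apply: iter_fix; apply: iter_next_valency. Qed.

Fact chain_subproof (a : barrow C) n : @is_qpath Q (barrow_src a) (traject next a n).
Proof. by elim: n a => //= n IHn a; rewrite eqxx /=; apply: (IHn (next a)). Qed.

Definition chain (a : barrow C) n : qpath Q :=
  @QPath Q (_, _) (chain_subproof a n).

Lemma chainE (p : qpath Q) a n : parrows p = traject next a n.+1 -> p = chain a n.+1.
Proof.
move=> pE; apply: val_inj; rewrite [val p]surjective_pairing /= -/(parrows p) pE.
by congr pair; have := valP p; rewrite -/(parrows p) pE /= => /andP[/eqP<-].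
Qed.

Lemma ptarget_chain a n : ptarget (chain a n) = barrow_src (iter n next a).
Proof.
rewrite /ptarget /psource /parrows /=.
by elim: n a => //= n IHn a; rewrite -[RHS]/(barrow_src (iter n.+1 next a)) iterSr -IHn.
Qed.

Lemma special_cycleE v (i : 'I_(valency v)) :
  special_cycle i = chain (mk_barrow i) (valency v).
Proof. exact: val_inj. Qed.

(** * Basis paths and the normal form of a path *)

Lemma exists_base_arrow (U : bc_index C) : exists a : barrow C, barrow_src a == U.
Proof.
have [v vU] : exists v, v \in bc_polygon U.
  have := bc_polygon_size U; case E: (bc_polygon U : seq _) => [//|v s] _.
  by exists v; rewrite -[_ \in _]/(v \in (bc_polygon U : seq _)) E mem_head.
have : U \in circ_order v.
  by rewrite -has_pred1 has_count /= bc_orderP mset_gt0.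
by case/tnthP=> i ->; exists (mk_barrow i).
Qed.

(** Fixes, among the full chains starting at [U], all equal in the quotient by (1), the one that
    serves as representative. *)
Definition base_arrow (U : bc_index C) : barrow C := xchoose (exists_base_arrow U).

Lemma base_arrow_src U : barrow_src (base_arrow U) = U.
Proof. exact/eqP/(xchooseP (exists_base_arrow U)). Qed.

(** The summands index the trivial paths, the full chains and the shorter chains; in the last one
    [l] stands for the length [l.+1], hence the bound [(cyc_len v).-1]. *)
Definition basis_index : finType :=
  (bc_index C + bc_index C + {v : bc_vertex C & 'I_(valency v) * 'I_(cyc_len v).-1})%type.

Definition mk_index v (i : 'I_(valency v)) (l : 'I_(cyc_len v).-1) : basis_index :=
  inr (existT (fun v => 'I_(valency v) * 'I_(cyc_len v).-1)%type v (i, l)).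

Definition basis_path (b : basis_index) : qpath Q :=
  match b with
  | inl (inl U) => @ptriv Q U
  | inl (inr U) => chain (base_arrow U) (cyc_len (tag (base_arrow U)))
  | inr (existT v (i, l)) => chain (mk_barrow i) l.+1
  end.

(** As [size s] is the length minus one, [insub] succeeds exactly on chains shorter than L(v). A
    full chain is remembered only through its starting polygon, which builds in relation (1). *)
Definition brauer_nf (p : qpath Q) : option basis_index :=
  if parrows p is a :: s then
    if fpath next a s then
      if insub (size s) is Some l then Some (mk_index (tagged a) l)
      else if (size s).+1 == cyc_len (tag a) then Some (inl (inr (psource p)))
      else None
    else None
  else Some (inl (inl (psource p))).

Lemma nf_short_chain v (i : 'I_(valency v)) (l : 'I_(cyc_len v).-1) :
  brauer_nf (chain (mk_barrow i) l.+1) = Some (mk_index i l).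
Proof.
by rewrite /brauer_nf /parrows /= fpath_traject size_traject valK.
Qed.

Lemma nf_cyc_chain (a : barrow C) n : n = cyc_len (tag a) ->
  brauer_nf (chain a n) = Some (inl (inr (barrow_src a))).
Proof.
move=> nL; have := cyc_len_gt0 (tagged a); rewrite -nL; case: n nL => // n nL _.
rewrite /brauer_nf /parrows /= fpath_traject size_traject nL eqxx insubN //.
by rewrite -leqNgt -nL.
Qed.

Lemma nf_long_chain (a : barrow C) n : (cyc_len (tag a) < n)%N ->
  brauer_nf (chain a n) = None.
Proof.
case: n => // n; rewrite /brauer_nf /parrows /= fpath_traject size_traject => Ln.
rewrite gtn_eqF // insubN // -leqNgt.
exact: leq_ltn_trans (leq_pred _) Ln.
Qed.

Lemma nf_none (p : qpath Q) : parrows p != [::] ->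
    (forall a n, p = chain a n.+1 -> (cyc_len (tag a) < n.+1)%N) ->
  brauer_nf p = None.
Proof.
case E: (parrows p) => [//|a s] _ long.
have [/fpathP[n sE]|nch] := boolP (fpath next a s); last first.
  by rewrite /brauer_nf E (negPf nch).
have pE : p = chain a n.+1 by apply: chainE; rewrite E sE.
by rewrite pE nf_long_chain ?long.
Qed.

Lemma nf_basis_path b : brauer_nf (basis_path b) = Some b.
Proof.
case: b => [[U|U]|[v [i l]]] //; first by rewrite /= nf_cyc_chain ?base_arrow_src.
exact: nf_short_chain.
Qed.

Lemma nth_chain_infix (a : barrow C) n s1 s s2 i x0 :
    traject next a n = s1 ++ s ++ s2 -> (i < size s)%N ->
  nth x0 s i = iter (size s1 + i) next a.
Proof.
move=> e lt_i; have lt_n : (size s1 + i < n)%N.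
  by rewrite -(size_traject next a n) e !size_cat ltn_add2l ltn_addr.
rewrite -(nth_traject _ lt_n) e (set_nth_default a) // nth_cat ltnNge leq_addr.
by rewrite /= addKn nth_cat lt_i.
Qed.

(** If the whole path is a chain, the infix forces it to run around the vertex of [a], so its total
    length is to be compared with the cycle length of that vertex. *)
Lemma nf_chain_infix (p : qpath Q) a n s1 s2 :
    parrows p = s1 ++ traject next a n.+1 ++ s2 ->
    (cyc_len (tag a) < size s1 + n.+1 + size s2)%N ->
  brauer_nf p = None.
Proof.
move=> pE lt_L; apply: nf_none => [|b N pb].
  by rewrite -size_eq0 pE !size_cat size_traject addnA addnS addSn.
have bE : traject next b N.+1 = s1 ++ traject next a n.+1 ++ s2 by rewrite -pE pb.
have := @nth_chain_infix _ _ _ _ _ 0 a bE isT; rewrite /= => aE.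
move: lt_L; rewrite aE tag_iter_next => /leq_trans->//.
by rewrite -(size_traject next b N.+1) bE !size_cat size_traject addnA.
Qed.

(** A full chain with any arrow added is too long or no chain. The result does not mention [a], so
    the two terms of relation (1) agree in every product with paths. *)
Lemma nf_cyc_infix (p : qpath Q) a s1 s2 :
    parrows p = s1 ++ traject next a (cyc_len (tag a)) ++ s2 ->
  brauer_nf p = if nilp s1 && nilp s2 then Some (inl (inr (psource p))) else None.
Proof.
have := cyc_len_gt0 (tagged a); case E: (cyc_len (tag a)) => [//|n] _ pE.
have [/andP[/nilP s10 /nilP s20]|nz] := ifPn.
  have -> : p = chain a n.+1 by apply: chainE; rewrite pE s10 s20 cats0.
  by rewrite nf_cyc_chain.
apply: nf_chain_infix pE _; rewrite E addnAC -[X in (X < _)%N]add0n ltn_add2r.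
by rewrite lt0n addn_eq0.
Qed.

Lemma nf_nonchain_infix (p : qpath Q) a b s1 s2 :
  parrows p = s1 ++ [:: a; b] ++ s2 -> b <> next a -> brauer_nf p = None.
Proof.
move=> pE ba; apply: nf_none => [|c N pc].
  by rewrite -size_eq0 pE !size_cat /= addnS.
have cE : traject next c N.+1 = s1 ++ [:: a; b] ++ s2 by rewrite -pE pc.
have := @nth_chain_infix _ _ _ _ _ 0 a cE isT.
have := @nth_chain_infix _ _ _ _ _ 1 a cE isT => /= bE aE.
by case: ba; rewrite bE aE addn0 addn1.
Qed.

(** * The Brauer relations in terms of chains *)

Variable k : fieldType.
Local Notation pa_basis := (@pa_basis k Q).
Local Notation proj := (qproj (@brauer_relation C k)).

Lemma pa_basis_chainD a m n :
  pa_basis (chain a (m + n)) = pa_basis (chain a m) * pa_basis (chain (iter m next a) n).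
Proof. by apply: pa_basis_cat => //; rewrite ?ptarget_chain // -trajectD. Qed.

Lemma arrow_eltE (a : barrow C) : arrow_elt k a = pa_basis (chain a 1).
Proof. by congr (pa_basis _); apply: val_inj. Qed.

Lemma cycle_eltX v (i : 'I_(valency v)) :
  cycle_elt k i ^+ bc_mu v = pa_basis (chain (mk_barrow i) (cyc_len v)).
Proof.
rewrite /cyc_len; case: (bc_mu v) (bc_mu_gt0 v) => // n _.
elim: n => [|n IHn].
  by rewrite expr1 mul1n /cycle_elt special_cycleE.
rewrite exprS IHn [in RHS]mulSn pa_basis_chainD /cycle_elt special_cycleE.
by rewrite (iter_next_valency (mk_barrow i)).
Qed.

Lemma cyc_chain_relation (a b : barrow C) : barrow_src a = barrow_src b ->
  brauer_relation (pa_basis (chain a (cyc_len (tag a)))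
                   - pa_basis (chain b (cyc_len (tag b)))).
Proof.
case: a b => [v i] [w j] ij; rewrite -(@cycle_eltX v i) -(@cycle_eltX w j).
exact: BrauerRel1.
Qed.

(** After L(v) steps the chain is back at its first arrow, so one more step gives relation (2). *)
Lemma long_chain_relation (a : barrow C) :
  brauer_relation (pa_basis (chain a (cyc_len (tag a)).+1)).
Proof.
rewrite -addn1 pa_basis_chainD iter_next_cyc_len; case: a => v i.
rewrite -(@cycle_eltX v i) -arrow_eltE; exact: BrauerRel2.
Qed.

Lemma proj_long_chain (a : barrow C) n : (cyc_len (tag a) < n)%N ->
  proj (pa_basis (chain a n)) = 0.
Proof.
move=> /subnKC <-; rewrite pa_basis_chainD; apply: qproj_eq0.
by apply/gen_idealMr/gen_ideal_sub/long_chain_relation.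
Qed.

Lemma proj_nonchain (p : qpath Q) a b s1 s2 :
  parrows p = s1 ++ [:: a, b & s2] -> b <> next a -> proj (pa_basis p) = 0.
Proof.
move=> pE ba; have := valP p; rewrite -/(parrows p) pE is_qpath_cat.
case/andP=> s1P /= /and3P[/eqP s1a /eqP ab s2P].
(* The path factors as [p1 * (a * b) * q2]; [p3] and [p2] are the tails starting at [a] and at
   [b]. *)
pose p1 : qpath Q := @QPath Q (_, _) s1P.
pose q2 : qpath Q := @QPath Q (_, _) s2P.
have bP : @is_qpath Q (barrow_src b) (b :: s2) by rewrite /= eqxx.
pose p2 : qpath Q := @QPath Q (_, _) bP.
have aP : @is_qpath Q (barrow_src a) [:: a, b & s2].
  by rewrite /= eqxx /= ab eqxx.
pose p3 : qpath Q := @QPath Q (_, _) aP.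
have -> : pa_basis p = pa_basis p1 * pa_basis p3 by apply: pa_basis_cat.
have -> : pa_basis p3 = arrow_elt k a * pa_basis p2 by apply: pa_basis_cat.
have -> : pa_basis p2 = arrow_elt k b * pa_basis q2 by apply: pa_basis_cat.
rewrite [arrow_elt k a * _]mulrA; apply: qproj_eq0.
apply/gen_idealMl/gen_idealMr/gen_ideal_sub.
by apply: BrauerRel3 => //; exact: esym.
Qed.

Lemma proj_basis_nf p :
  proj (pa_basis p) = oapp (fun b => proj (pa_basis (basis_path b))) 0 (brauer_nf p).
Proof.
case E: (parrows p) => [|a s].
  rewrite /brauer_nf E /=; congr (proj (pa_basis _)); apply: val_inj.
  by rewrite [LHS]surjective_pairing -/(parrows p) E.
have [/fpathP[n sE]|nch] := boolP (fpath next a s); last first.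
  rewrite /brauer_nf E (negPf nch) /=.
  have [s1 [b [c [s2 [sE bc]]]]] := not_fpath_split nch.
  by apply: proj_nonchain bc; rewrite E sE.
have {s E sE} -> : p = chain a n.+1 by apply: chainE; rewrite E sE.
have [ltL|gtL|eqL] := ltngtP n.+1 (cyc_len (tag a)).
- have ltl : (n < (cyc_len (tag a)).-1)%N by rewrite -ltnS (ltn_predK ltL).
  case: a ltL ltl => v i _ ltl.
  by rewrite -[chain _ _]/(chain (mk_barrow i) (Ordinal ltl).+1) nf_short_chain.
- by rewrite nf_long_chain //= proj_long_chain.
rewrite eqL nf_cyc_chain //=; apply/qprojP/gen_ideal_sub/cyc_chain_relation.
by rewrite base_arrow_src.
Qed.

Lemma nf_coord_relation b s p q : brauer_relation s ->
  nf_coord brauer_nf b (pa_basis p * s * pa_basis q) = 0.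
Proof.
have nf0 t : brauer_nf t = None -> nf_coord brauer_nf b (pa_basis t) = 0.
  by move=> tN; rewrite nf_coord_basis tN.
case=> [v w i j ij|v i|a c acN ca].
(* The two full chains are parallel, so [p] and [q] compose with both or with neither; in the first
   case the normal forms coincide. *)
- rewrite !cycle_eltX mulrBr mulrBl nf_coordB.
  set ci := chain (mk_barrow i) _; set cj := chain (mk_barrow j) _.
  have srcij : psource cj = psource ci by apply: esym.
  have tgtij : ptarget cj = ptarget ci.
    rewrite !ptarget_chain (iter_next_cyc_len (mk_barrow i)).
    by rewrite (iter_next_cyc_len (mk_barrow j)); exact: esym.
  case: (pa_basis_mul3 k p q ci) => [z|pq]; first by rewrite !z // nf_coord0 subr0.
  have [ti -> tiE] := pq ci erefl erefl; have [tj -> tjE] := pq cj srcij tgtij.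
  rewrite !nf_coord_basis; apply/eqP; rewrite subr_eq0; apply/eqP.
  rewrite (@nf_cyc_infix ti (mk_barrow i) (parrows p) (parrows q)).
    2: by rewrite /(parrows ti) tiE.
  rewrite (@nf_cyc_infix tj (mk_barrow j) (parrows p) (parrows q)).
    2: by rewrite /(parrows tj) tjE.
  by rewrite /(psource ti) tiE /(psource tj) tjE.
(* The last arrow is written as the one reached after L(v) steps, which turns the product into a
   single chain. *)
- rewrite cycle_eltX arrow_eltE -[X in pa_basis (chain X 1)]iter_next_cyc_len.
  rewrite -pa_basis_chainD addn1.
  case: (pa_basis_mul3 k p q (chain (mk_barrow i) (cyc_len v).+1)) => [z|pq].
    by rewrite z // nf_coord0.
  have [t -> tE] := pq _ erefl erefl; apply: nf0.
  apply: (@nf_chain_infix t (mk_barrow i) (cyc_len v) (parrows p) (parrows q)).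
    by rewrite /(parrows t) tE.
  by rewrite addnS addSn ltnS -addnA addnCA leq_addr.
have acP : @is_qpath Q (barrow_src a) [:: a; c].
  by rewrite /= eqxx /= acN eqxx.
have -> : arrow_elt k a * arrow_elt k c = pa_basis (@QPath Q (_, _) acP).
  by apply/esym/pa_basis_cat.
case: (pa_basis_mul3 k p q (@QPath Q (_, _) acP)) => [z|pq].
  by rewrite z // nf_coord0.
have [t -> tE] := pq _ erefl erefl; apply: nf0.
by apply: nf_nonchain_infix ca; rewrite /(parrows t) tE.
Qed.

(** Trivial paths and full chains give one element each per polygon; a shorter chain is a starting
    position and a length. *)
Theorem brauer_algebra_dim :
  lmod_dim (brauer_algebra C k)
    (2 * #|bc_index C| + \sum_v valency v * (cyc_len v).-1).
Proof.
have -> : (2 * #|bc_index C| + \sum_v valency v * (cyc_len v).-1)%N = #|basis_index|.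
  rewrite !card_sum addnn mul2n card_tagged sumnE big_map big_enum /=.
  by congr (_ + _)%N; apply: eq_bigr => v _; rewrite card_prod !card_ord.
apply: quotient_dim_nf nf_basis_path proj_basis_nf nf_coord_relation.
Qed.

End BrauerDimension.

(** * Valencies and index of coincidence of a ciphertext *)

Lemma sum_count_vigenere_list (A : finType) m (y : seq A) (a : A) : (0 < m)%N ->
  (\sum_(i < m) count_mem a (vigenere_list y i) = count_mem a y)%N.
Proof.
move=> m_gt0.
under eq_bigr do rewrite (vigenere_listE a) count_map count_filter -sum1_count.
rewrite -[in RHS](mkseq_nth a y) count_map -[RHS]sum1_count.
(* Position [j] belongs to exactly one list, the one of index [j %% m]. *)
rewrite (exchange_big_dep (fun j => nth a y j == a)) /= => [|i j _ /andP[] //].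
apply: eq_bigr => j ja; rewrite (big_pred1 (Ordinal (ltn_pmod j m_gt0))) // => i.
by rewrite ja /= (modn_small (ltn_ord i)) -val_eqE eq_sym.
Qed.

Lemma valency_vigenere (A : finType) m (y : seq A) (m_gt0 : (0 < m)%N)
    (y_freq : forall a : A, (1 < count_mem a y)%N)
    (y_lists : forall i : 'I_m, (1 < size (vigenere_list y i))%N) (a : A) :
  @valency (vigenere_configuration m_gt0 y_freq y_lists) a = count_mem a y.
Proof.
rewrite -(sum_count_vigenere_list _ _ m_gt0); apply: eq_bigr => i _.
exact: mset_seqE.
Qed.

Lemma index_of_coincidenceE (A : finType) (y : seq A) : (1 < size y)%N ->
  (size y)%:R * ((size y)%:R - 1) * index_of_coincidence y
  = (\sum_(a : A) count_mem a y * (count_mem a y).-1)%:R.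
Proof.
move=> y_gt1; have y_gt0 := ltnW y_gt1.
have nz : (size y)%:R * ((size y)%:R - 1) != 0 :> rat.
  by apply: mulf_neq0; rewrite ?subr_eq0 ?pnatr_eq1 ?pnatr_eq0 gtn_eqF.
rewrite /index_of_coincidence -mulr_suml mulrCA mulfV // mulr1 natr_sum.
(* The predecessor on naturals is truncated; at frequency 0 both products vanish. *)
apply: eq_bigr => a _; rewrite natrM; case: (count_mem a y) => [|f].
  by rewrite !mul0r.
by rewrite -natr1 addrK.
Qed.

Theorem theorem2 (k : fieldType) (A : finType) (n : nat)
    (code : A -> 'I_n.+1) (decode : 'I_n.+1 -> A)
    (codeK : cancel code decode) (decodeK : cancel decode code)
    (m : nat) (m_gt0 : (0 < m)%N) (K : m.-tuple 'I_n.+1)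
    (x y : seq A) (y_cipher : y = vigenere_encrypt code decode K x)
    (y_freq : forall a : A, (1 < count_mem a y)%N)
    (y_lists : forall i : 'I_m, (1 < size (vigenere_list y i))%N) :
  exists d : nat,
    lmod_dim (brauer_algebra (vigenere_configuration m_gt0 y_freq y_lists) k) d /\
    d%:R = 2 * m%:R
           + (size y)%:R * ((size y)%:R - 1) * index_of_coincidence y :> rat.
Proof.
(* Any list is a subsequence of [y] with at least two letters; this keeps the denominator of the
   index non-zero. *)
have y_gt1 : (1 < size y)%N.
  apply: leq_trans (y_lists (Ordinal m_gt0)) _.
  exact: size_subseq (mask_subseq _ _).
eexists; split; first exact: brauer_algebra_dim.
rewrite natrD natrM card_ord index_of_coincidenceE //; congr (_ + _%:R).
by apply: eq_bigr => a _; rewrite /cyc_len mul1n valency_vigenere.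
Qed.
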